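(* Let $A$ be a subset of a Banach space $X$ and let $B$ be a convex subset of a Banach space $Y$. If $A$ is strongly finitely representable in $B$, then there exist a free ultrafilter $\mathcal U$ on some index set $I$ and an affine isometry $T:\mathrm{aff}(A)\to(\mathrm{aff}(B))_{\mathcal U}$ such that $T(A)\subset(B)_{\mathcal U}$.
   Context: A convex polyhedron in a Banach space is the convex hull $H$ of finitely many points; its vertex set $\mathrm{vert}(H)$ is its (finite) set of extreme points. For non-negative integers $n,m$, an $(n,m)$-polyhedron is a convex polyhedron $H$ whose affine hull $\mathrm{aff}(H)$ has dimension $n$ and which has exactly $n+m+1$ vertices. For a Banach space $Y$ with closed unit ball $B_Y$, the Hausdorff distance of nonempty bounded sets $C,D\subset Y$ is $d_{\mathfrak H}(C,D)=\inf\{r>0: C\subset D+rB_Y,\ D\subset C+rB_Y\}$. Let $X,Y$ be Banach spaces, $A\subset X$, $B\subset Y$. Given $\varepsilon>0$, $A$ is $\varepsilon$-strongly finitely representable in $B$ if for every pair $n,m$ of non-negative integers and every $(n,m)$-polyhedron $H\subset X$ with $\mathrm{vert}(H)\subset A$, there exist an $(n,m)$-polyhedron $H'\subset Y$ with $\mathrm{vert}(H')\subset B$ and an affine isomorphism $T:\mathrm{aff}(H)\to\mathrm{aff}(H')$ such that $(1-\varepsilon)\|x-y\|\le\|Tx-Ty\|\le(1+\varepsilon)\|x-y\|$ for all $x,y\in\mathrm{aff}(H)$ and $d_{\mathfrak H}(\mathrm{vert}(T(H)),\mathrm{vert}(H'))<\varepsilon$. $A$ is strongly finitely representable in $B$ if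 it is $\varepsilon$-strongly finitely representable in $B$ for all $\varepsilon>0$. Ultrapowers of sets: for a subset $C$ of a Banach space $Y$ and an ultrafilter $\mathcal U$ on a set $I$, two families $(a_i)_{i\in I},(b_i)_{i\in I}\in C^I$ are equivalent if $\{i\in I:\|a_i-b_i\|<\varepsilon\}\in\mathcal U$ for every $\varepsilon>0$; the ultrapower $(C)_{\mathcal U}$ is the set of equivalence classes $(a_i)_{\mathcal U}$ of elements of $C^I$. If $C\subset D\subset Y$, then $(C)_{\mathcal U}$ is regarded as a subset of $(D)_{\mathcal U}$ (the classes having a representative in $C^I$). Affine combinations in $(\mathrm{aff}(B))_{\mathcal U}$ are formed coordinatewise, and distances are given by $\|(a_i)_{\mathcal U}-(b_i)_{\mathcal U}\|=\lim_{\mathcal U}\|a_i-b_i\|\in[0,\infty]$. An affine isometry is an affine map preserving distances (not necessarily surjective). A free ultrafilter is one whose members have empty intersection. *)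

(* Defs.v *)
From HB Require Import structures.
From mathcomp Require Import all_boot all_order all_algebra.
From mathcomp Require Import all_classical all_reals all_analysis.
Import Order.TTheory GRing.Theory Num.Theory.
Import numFieldNormedType.Exports.

Set Implicit Arguments.
Unset Strict Implicit.
Unset Printing Implicit Defensive.

Local Open Scope classical_set_scope.
Local Open Scope ring_scope.
Local Open Scope quotient_scope.

Section AffineGeometry.
Context {R : realType}.
Implicit Type V : lmodType R.

Definition aff V (S : set V) : set V :=
  [set x | exists n (t : 'I_n -> R) (s : 'I_n -> V),
     [/\ forall i, S (s i), \sum_i t i = 1 & x = \sum_i t i *: s i]].

Definition convex_hull V (S : set V) : set V :=
  [set x | exists n (t : 'I_n -> R) (s : 'I_n -> V),
     [/\ forall i, S (s i), forall i, 0 <= t i, \sum_i t i = 1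
       & x = \sum_i t i *: s i]].

Definition convex_polyhedron V (H : set V) : Prop :=
  exists2 F : set V, finite_set F & H = convex_hull F.

(* the extreme points of H *)
Definition vert V (H : set V) : set V :=
  [set x | H x /\ forall y z (t : R), H y -> H z -> 0 < t < 1 ->
     x = t *: y + (1 - t) *: z -> y = x /\ z = x].

Definition lin_indep V n (v : 'I_n -> V) : Prop :=
  forall c : 'I_n -> R, \sum_i c i *: v i = 0 -> forall i, c i = 0.

(* D is a translate of an n-dimensional linear subspace. *)
Definition affine_dim V (D : set V) (n : nat) : Prop :=
  exists (x0 : V) (v : 'I_n -> V), lin_indep v /\
    D = [set x0 + \sum_i c i *: v i | c in [set: 'I_n -> R]].

Definition nm_polyhedron V (n m : nat) (H : set V) : Prop :=
  [/\ convex_polyhedron H, affine_dim (aff H) n & (vert H #= `I_(n + m + 1))%card].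

Definition affine_on V (W : lmodType R) (D : set V) (T : V -> W) : Prop :=
  forall x y (t : R), D x -> D y ->
    T (t *: x + (1 - t) *: y) = t *: T x + (1 - t) *: T y.

(* Values of T outside D are irrelevant. *)
Definition affine_iso V (W : lmodType R) (D : set V) (E : set W)
    (T : V -> W) : Prop :=
  affine_on D T /\ set_bij D E T.

End AffineGeometry.

Section StrongFiniteRepresentability.
Context {R : realType}.

(* Extended-valued, so that the infimum of the empty set is +oo; it is finite
   on nonempty bounded sets. *)
Definition hausdorff_dist (Y : normedModType R) (C D : set Y) : \bar R :=
  let thicken (E : set Y) (r : R) :=
    [set e + r *: b | e in E & b in closed_ball (0 : Y) 1] in
  ereal_inf [set r%:E | r in
    [set r : R | [/\ 0 < r, C `<=` thicken D r & D `<=` thicken C r]]].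

Definition eps_strongly_finitely_representable (X Y : normedModType R)
    (eps : R) (A : set X) (B : set Y) : Prop :=
  forall (n m : nat) (H : set X), nm_polyhedron n m H -> vert H `<=` A ->
  exists (H' : set Y) (T : X -> Y),
    [/\ nm_polyhedron n m H',
        vert H' `<=` B,
        affine_iso (aff H) (aff H') T,
        forall x y, aff H x -> aff H y ->
          (1 - eps) * `|x - y| <= `|T x - T y| <= (1 + eps) * `|x - y|
      & (hausdorff_dist (vert (T @` H)) (vert H') < eps%:E)%E].

Definition strongly_finitely_representable (X Y : normedModType R)
    (A : set X) (B : set Y) : Prop :=
  forall eps : R, 0 < eps -> eps_strongly_finitely_representable eps A B.

End StrongFiniteRepresentability.

Definition free_filter (I : Type) (U : set_system I) : Prop :=
  \bigcap_(S in U) S = set0.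

(* The quotient of all of Y^I, unbounded families included; the ultrapowers of
   subsets of Y are subsets of it. *)
Section Ultrapower.
Context {R : realType} (Y : normedModType R).
Context {I : Type} (U : set_system I) {FU : Filter U}.
Implicit Types (a b c : I -> Y) (C : set Y).

Definition ultra_eq a b : bool :=
  `[< forall e : R, 0 < e -> \forall i \near U, `|a i - b i| < e >].

Lemma ultra_eq_refl : reflexive ultra_eq.
Proof.
by move=> a; apply/asboolP => e e0; apply: nearW => i; rewrite subrr normr0.
Qed.

Lemma ultra_eq_sym : symmetric ultra_eq.
Proof.
move=> a b; apply/idP/idP => /asboolP ab; apply/asboolP => e /ab;
  by apply: filterS => i; rewrite distrC.
Qed.

Lemma ultra_eq_trans : transitive ultra_eq.
Proof.
move=> b a c /asboolP ab /asboolP bc; apply/asboolP => e e0.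
have e20 : 0 < e / 2 by rewrite divr_gt0.
near=> i; rewrite [e]splitr (le_lt_trans (ler_distD (b i) _ _))// ltrD//.
  by near: i; exact: ab.
by near: i; exact: bc.
Unshelve. all: by end_near. Qed.

Canonical ultra_equiv_rel :=
  EquivRel ultra_eq ultra_eq_refl ultra_eq_sym ultra_eq_trans.

Definition ultra_quot := {eq_quot ultra_equiv_rel}.

HB.instance Definition _ := EqQuotient.on ultra_quot.

Lemma ultra_quotP a b : \pi_ultra_quot a = \pi_ultra_quot b <->
  forall e : R, 0 < e -> \forall i \near U, `|a i - b i| < e.
Proof.
by split => [/eqmodP/asboolP//|ab]; apply/eqmodP/asboolP.
Qed.

Definition ultrapower C : set ultra_quot :=
  [set \pi_ultra_quot a | a in [set a : I -> Y | forall i, C (a i)]].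

(* The affine combination t u + (1 - t) v. *)
Definition ultra_comb (t : R) (u v : ultra_quot) : ultra_quot :=
  \pi_ultra_quot (fun i => t *: repr u i + (1 - t) *: repr v i).

Lemma ultra_comb_pi t a b :
  ultra_comb t (\pi_ultra_quot a) (\pi_ultra_quot b) =
  \pi_ultra_quot (fun i => t *: a i + (1 - t) *: b i).
Proof.
apply/ultra_quotP => e e0.
have /ultra_quotP aa : \pi_ultra_quot (repr (\pi_ultra_quot a)) =
  \pi_ultra_quot a by rewrite reprK.
have /ultra_quotP bb : \pi_ultra_quot (repr (\pi_ultra_quot b)) =
  \pi_ultra_quot b by rewrite reprK.
pose M : R := `|t| + `|1 - t| + 1.
have M0 : 0 < M by rewrite ltr_wpDl// addr_ge0.
have d0 : 0 < e / M by rewrite divr_gt0.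
near=> i.
have -> : t *: repr (\pi_ultra_quot a) i + (1 - t) *: repr (\pi_ultra_quot b) i
    - (t *: a i + (1 - t) *: b i) =
    t *: (repr (\pi_ultra_quot a) i - a i) +
    (1 - t) *: (repr (\pi_ultra_quot b) i - b i).
  by rewrite !scalerBr opprD addrACA.
apply: le_lt_trans (ler_normD _ _) _; rewrite !normrZ.
apply: (@le_lt_trans _ _ ((`|t| + `|1 - t|) * (e / M))).
  rewrite mulrDl lerD// ler_wpM2l// ltW//; near: i; [exact: aa|exact: bb].
by rewrite -[ltRHS](divfK (lt0r_neq0 M0)) mulrC ltr_pM2l// ltrDl.
Unshelve. all: by end_near. Qed.

Definition ultra_dist (u v : ultra_quot) : \bar R :=
  lim ((`|repr u i - repr v i|%:E)%E @[i --> U]).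

Lemma ultra_dist_pi a b :
  ultra_dist (\pi_ultra_quot a) (\pi_ultra_quot b) =
  lim ((`|a i - b i|%:E)%E @[i --> U]).
Proof.
have /ultra_quotP aa : \pi_ultra_quot (repr (\pi_ultra_quot a)) =
  \pi_ultra_quot a by rewrite reprK.
have /ultra_quotP bb : \pi_ultra_quot (repr (\pi_ultra_quot b)) =
  \pi_ultra_quot b by rewrite reprK.
have close (f g : I -> R) (l : \bar R) :
    (forall e : R, 0 < e -> \forall i \near U, `|f i - g i| < e) ->
    (f i)%:E @[i --> U] --> l -> (g i)%:E @[i --> U] --> l.
  move=> fg; case: l => [l||].
  - move=> /fine_cvgP[_ /cvgrPdist_lt fl].
    apply/fine_cvgP; split; first exact: nearW.
    apply/cvgrPdist_lt => e e0.
    have e20 : 0 < e / 2 by rewrite divr_gt0.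
    near=> i; rewrite [e]splitr (le_lt_trans (ler_distD (f i) _ _))// ltrD//.
      by near: i; exact: fl.
    by near: i; exact: fg.
  - move=> /cvgeyPge fy; apply/cvgeyPge => M.
    have := fy (M + 1); have := fg 1 ltr01; apply: filterS2 => i.
    rewrite !lee_fin ltr_distl => /andP[_ h1] h2.
    by rewrite -(lerD2r 1) (le_trans h2)// ltW.
  - move=> /cvgeNyPle fy; apply/cvgeNyPle => M.
    have := fy (M - 1); have := fg 1 ltr01; apply: filterS2 => i.
    rewrite !lee_fin ltr_distl => /andP[h1 _] h2.
    by rewrite -(lerD2r (-1)) (le_trans _ h2)// ltW.
have dd (e : R) : 0 < e -> \forall i \near U,
    `| `|repr (\pi_ultra_quot a) i - repr (\pi_ultra_quot b) i|
       - `|a i - b i| | < e.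
  move=> e0; have e20 : 0 < e / 2 by rewrite divr_gt0.
  near=> i; apply: le_lt_trans (ler_dist_dist _ _) _.
  rewrite opprD addrACA -opprD [e]splitr.
  apply: le_lt_trans (ler_normB _ _) _; rewrite ltrD//.
    by near: i; exact: aa.
  by near: i; exact: bb.
rewrite /ultra_dist /lim; congr get; apply/funext => l; apply/propext.
split; apply: close => // e /dd.
by apply: filterS => i; rewrite distrC.
Unshelve. all: by end_near. Qed.

End Ultrapower.

Arguments ultrapower {R Y I} U {FU} C.
Arguments ultra_comb {R Y I} U {FU} t u v.
Arguments ultra_dist {R Y I} U {FU} u v.
Arguments ultra_quot {R} Y {I} U {FU}.

(* Values of T outside D are irrelevant. *)
Definition ultra_affine_isometry {R : realType} (X Y : normedModType R)
    (I : Type) (U : set_system I) {FU : Filter U} (D : set X)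
    (T : X -> ultra_quot Y U) : Prop :=
  (forall x y (t : R), D x -> D y ->
     T (t *: x + (1 - t) *: y) = ultra_comb U t (T x) (T y)) /\
  (forall x y, D x -> D y -> ultra_dist U (T x) (T y) = (`|x - y|%:E)%E).

(* Main.v *)
Require Import Defs.
From mathcomp Require Import all_boot all_order all_algebra finmap.
From mathcomp Require Import all_classical all_reals all_analysis.
From mathcomp Require Import ring lra.
Import Order.TTheory GRing.Theory Num.Theory.
Import numFieldNormedType.Exports.
Local Open Scope classical_set_scope.
Local Open Scope ring_scope.

(** Fix a finite set F of points of A and e > 0. The polytope H spanned by F
    has all its vertices in F, so strong finite representability supplies an
    affine e-isometry S on aff F that sends the vertices of H to within e of
    points of B. A point of F that is not a vertex is a convex combination of
    vertices, and B is convex, so S sends every point of F to within e of a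
    point of B. Replacing S on F by such nearby points gives a map
    b : A -> B; it need not be affine, but for every combination of points of
    F whose coefficients sum to 0, the norm of the combination is preserved
    by b up to an error that tends to 0 with e (almost_isometric_copy).

    The pairs (F, k), with e = 1 / (k + 1), are directed by enlarging F and k,
    and an ultrafilter U containing all the cones of this order is free
    (cone_ultrafilter). Choose for each x in aff A one expression
    x = sum_j t_j a_j as an affine combination of points of A, and send x to
    the class of the family (sum_j t_j b_i(a_j)) indexed by i = (F, k). All
    that has to be checked concerns a combination with coefficients of sum 0:
    in t x + (1 - t) y minus the same combination of the expressions of x and
    y, or in a minus the expression of a, this combination vanishes in X, so
    its images tend to 0 along U; in the difference of the expressions of x
    and y, the norms of its images tend to the norm of x - y. Thus the
    resulting map is affine and isometric and maps A to the classes of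
    families in B.

    Two facts on polytopes are needed to apply the hypothesis: a polytope is
    the hull of its vertices (hull_vertP), and the hull of finitely many points
    is an (n, m)-polyhedron for some n and m (polyhedronP). *)

(** * Formal linear combinations *)

Section Combinations.
Context {R : realType}.

(** A combination is kept as a list of (coefficient, index) pairs, so that
    sums, multiples and subcombinations are concatenations, maps and filters,
    and so that one combination can be evaluated through several maps f. *)
Definition weight {I : Type} (l : seq (R * I)) : R := \sum_(p <- l) p.1.

Definition lincomb {I : Type} {V : lmodType R} (f : I -> V) (l : seq (R * I)) : V :=
  \sum_(p <- l) p.1 *: f p.2.

Definition rescale {I : Type} (c : R) (l : seq (R * I)) : seq (R * I) :=
  [seq (c * p.1, p.2) | p <- l].

Lemma weight_cons (I : Type) p (l : seq (R * I)) :
  weight (p :: l) = p.1 + weight l.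
Proof. by rewrite /weight big_cons. Qed.

Lemma weight_cat (I : Type) (l m : seq (R * I)) :
  weight (l ++ m) = weight l + weight m.
Proof. by rewrite /weight big_cat. Qed.

Lemma weight_rescale (I : Type) c (l : seq (R * I)) :
  weight (rescale c l) = c * weight l.
Proof. by rewrite /weight big_map big_distrr. Qed.

Lemma lincomb_cons (I : Type) (V : lmodType R) (f : I -> V) p l :
  lincomb f (p :: l) = p.1 *: f p.2 + lincomb f l.
Proof. by rewrite /lincomb big_cons. Qed.

Lemma lincomb_cat (I : Type) (V : lmodType R) (f : I -> V) l m :
  lincomb f (l ++ m) = lincomb f l + lincomb f m.
Proof. by rewrite /lincomb big_cat. Qed.

Lemma lincomb_rescale (I : Type) (V : lmodType R) (f : I -> V) c l :
  lincomb f (rescale c l) = c *: lincomb f l.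
Proof.
by rewrite /lincomb big_map scaler_sumr; apply: eq_bigr => p _; rewrite scalerA.
Qed.

Lemma lincomb_map (I J : Type) (V : lmodType R) (f : J -> V) (g : I -> J) l :
  lincomb f [seq (p.1, g p.2) | p <- l] = lincomb (f \o g) l.
Proof. by rewrite /lincomb big_map. Qed.

Lemma weight_map (I J : Type) (g : I -> J) (l : seq (R * I)) :
  weight [seq (p.1, g p.2) | p <- l] = weight l.
Proof. by rewrite /weight big_map. Qed.

Lemma lincomb_pair (I : Type) (V W : lmodType R) (f : I -> V) (g : I -> W) l :
  lincomb (fun x => (f x, g x)) l = (lincomb f l, lincomb g l).
Proof.
by elim: l => [|p l IH]; rewrite ?lincomb_cons ?IH// /lincomb !big_nil.
Qed.

Lemma lincomb_weight0 (I : eqType) (V : lmodType R) (f : I -> V) l :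
  (forall p, p \in l -> 0 <= p.1) -> weight l = 0 -> lincomb f l = 0.
Proof.
move=> l0 wl; apply: big1_seq => p /= pl.
have : \sum_(q <- l | q \in l) q.1 = 0 by rewrite -big_seq.
move/eqP; rewrite psumr_eq0// => /allP /(_ p pl); rewrite pl /= => /eqP ->.
exact: scale0r.
Qed.

Lemma weight_ge0 (I : eqType) (l : seq (R * I)) :
  (forall p, p \in l -> 0 <= p.1) -> 0 <= weight l.
Proof. by move=> l0; rewrite /weight big_seq sumr_ge0. Qed.

Implicit Type V : lmodType R.

Lemma lincomb_ord V n (t : 'I_n -> R) (s : 'I_n -> V) :
  let l := [seq (t i, s i) | i <- index_enum 'I_n] in
  weight l = \sum_i t i /\ lincomb id l = \sum_i t i *: s i.
Proof. by rewrite /= /weight /lincomb !big_map. Qed.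

Lemma affP V (S : set V) x : aff S x <->
  exists l, [/\ forall p, p \in l -> S p.2, weight l = 1 & lincomb id l = x].
Proof.
split=> [[n [t [s [Ss t1 ->]]]]|[l [Sl l1 <-]]].
  exists [seq (t i, s i) | i <- index_enum 'I_n].
  have [wE ->] := lincomb_ord V n t s; split; rewrite ?wE//.
  by move=> _ /mapP[i _ ->]; exact: Ss.
exists (size l), (fun i => (tnth (in_tuple l) i).1), (fun i => (tnth (in_tuple l) i).2).
split.
- by move=> i; apply: Sl; apply: mem_tnth.
- by rewrite -l1 /weight [RHS]big_tnth.
- by rewrite /lincomb [LHS]big_tnth.
Qed.

Lemma convex_hullP V (S : set V) x : convex_hull S x <->
  exists l, [/\ forall p, p \in l -> S p.2, forall p, p \in l -> 0 <= p.1,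
                weight l = 1 & lincomb id l = x].
Proof.
split=> [[n [t [s [Ss t0 t1 ->]]]]|[l [Sl l0 l1 <-]]].
  exists [seq (t i, s i) | i <- index_enum 'I_n].
  have [wE ->] := lincomb_ord V n t s; split; rewrite ?wE//.
    by move=> _ /mapP[i _ ->]; exact: Ss.
  by move=> _ /mapP[i _ ->]; exact: t0.
exists (size l), (fun i => (tnth (in_tuple l) i).1), (fun i => (tnth (in_tuple l) i).2).
split.
- by move=> i; apply: Sl; apply: mem_tnth.
- by move=> i; apply: l0; apply: mem_tnth.
- by rewrite -l1 /weight [RHS]big_tnth.
- by rewrite /lincomb [LHS]big_tnth.
Qed.

Lemma mem_rescale (I : eqType) c (l : seq (R * I)) p :
  p \in rescale c l -> exists2 q, q \in l & p = (c * q.1, q.2).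
Proof. by move/mapP. Qed.

(** * Affine hulls *)

Lemma sub_aff V (S : set V) : S `<=` aff S.
Proof.
move=> x Sx; apply/affP; exists [:: (1, x)].
rewrite /weight /lincomb !big_seq1 scale1r; split=> // p.
by rewrite inE => /eqP ->.
Qed.

Lemma aff_line V (S : set V) x y (t : R) :
  aff S x -> aff S y -> aff S (t *: x + (1 - t) *: y).
Proof.
move=> /affP[l [Sl l1 <-]] /affP[m [Sm m1 <-]]; apply/affP.
exists (rescale t l ++ rescale (1 - t) m); split.
- by move=> p; rewrite mem_cat => /orP[] /mem_rescale[q ql ->];
    [exact: Sl ql|exact: Sm ql].
- by rewrite weight_cat !weight_rescale l1 m1; ring.
- by rewrite lincomb_cat !lincomb_rescale.
Qed.

(** Binary affine combinations generate all of them: by homogeneity one can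
    double the coefficients of two partial combinations based at x0 and take
    the midpoint, which avoids dividing by a possibly zero partial sum. *)
Lemma aff_sub V (S G : set V) :
  (forall x y (t : R), G x -> G y -> G (t *: x + (1 - t) *: y)) ->
  S `<=` G -> aff S `<=` G.
Proof.
move=> Gline SG _ /affP[[|[a x0] l0] [Sl l1 <-]].
  by move: l1; rewrite /weight big_nil => /eqP; rewrite eq_sym oner_eq0.
have Gx0 : G x0 by apply/SG/(Sl (a, x0)); rewrite mem_head.
set l := (a, x0) :: l0 in Sl l1 *.
have Gl k c : (forall p, p \in k -> S p.2) ->
    G (c *: lincomb id k + (1 - c * weight k) *: x0).
  elim: k c => [c _|[b x] k IH c Sk].
    by rewrite /lincomb /weight !big_nil scaler0 add0r mulr0 subr0 scale1r.
  rewrite lincomb_cons weight_cons /=.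
  have -> : c *: (b *: x + lincomb id k) + (1 - c * (b + weight k)) *: x0 =
      2^-1 *: ((2 * c * b) *: x + (1 - 2 * c * b) *: x0) +
      (1 - 2^-1) *: ((2 * c) *: lincomb id k + (1 - 2 * c * weight k) *: x0).
    rewrite !scalerDr !scalerA [RHS]addrACA -scalerDl.
    by congr (_ *: _ + _ *: _ + _ *: _); field.
  apply: (Gline); last by apply: IH => p pk; apply: Sk; rewrite inE pk orbT.
  by apply: Gline => //; apply/SG/(Sk (b, x)); rewrite mem_head.
by have := Gl l 1 Sl; rewrite l1 mul1r subrr scale0r addr0 scale1r.
Qed.

Lemma lincomb_aff V (S : set V) l :
  (forall p, p \in l -> S p.2) -> weight l = 1 -> aff S (lincomb id l).
Proof. by move=> Sl l1; apply/affP; exists l. Qed.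

Lemma aff_hull V (S : set V) : aff (convex_hull S) = aff S.
Proof.
apply/seteqP; split.
  apply: aff_sub => [|x /convex_hullP[l [Sl _ l1 <-]]]; last exact: lincomb_aff.
  exact: aff_line.
apply: aff_sub; first exact: aff_line.
move=> x Sx; apply: sub_aff; apply/convex_hullP; exists [:: (1, x)].
rewrite /weight /lincomb !big_seq1 scale1r; split=> // p; rewrite inE => /eqP -> //=.
Qed.

(** The graph of T over aff S is closed under binary affine combinations,
    hence contains every affine combination of its points. *)
Lemma affine_on_lincomb (V W : lmodType R) (S : set V) (T : V -> W) l :
  affine_on (aff S) T -> (forall p, p \in l -> S p.2) -> weight l = 1 ->
  T (lincomb id l) = lincomb T l.
Proof.
move=> Taff Sl l1.
pose G := [set z : V * W | aff S z.1 /\ T z.1 = z.2].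
pose l' := [seq (p.1, (p.2, T p.2)) | p <- l].
suff [_] : G (lincomb id l').
  by rewrite (lincomb_map _ _ _ id (fun x => (x, T x))) (lincomb_pair _ _ _ id T).
apply: (@aff_sub _ [set z | S z.1 /\ T z.1 = z.2] G).
- move=> x y t [Sx Tx] [Sy Ty]; split=> /=; first exact: aff_line.
  by rewrite Taff// Tx Ty.
- by move=> z [Sz Tz]; split=> //; exact: sub_aff.
- apply: lincomb_aff; last by rewrite (weight_map _ _ (fun x => (x, T x))).
  by move=> _ /mapP[p pl ->]; split=> //; exact: Sl.
Qed.

(** * Convex hulls *)

Lemma convex_setP V (G : set V) : convex_set G <->
  forall x y (t : R), G x -> G y -> 0 <= t <= 1 -> G (t *: x + (1 - t) *: y).
Proof.
split=> [cG x y t Gx Gy t01|cG x y t /set_mem Gx /set_mem Gy].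
  have := cG x y (Itv01 (proj1 (andP t01)) (proj2 (andP t01))).
  by rewrite !inE; exact.
by apply/mem_set/cG => //; rewrite ge0 le1.
Qed.

Lemma sub_hull V (S : set V) : S `<=` convex_hull S.
Proof.
move=> x Sx; apply/convex_hullP; exists [:: (1, x)].
rewrite /weight /lincomb !big_seq1 scale1r; split=> // p; rewrite inE => /eqP -> //=.
Qed.

Lemma hull_convex V (S : set V) : convex_set (convex_hull S).
Proof.
apply/convex_setP => x y t /convex_hullP[l [Sl l0 l1 <-]].
move=> /convex_hullP[m [Sm m0 m1 <-]] /andP[t0 t1]; apply/convex_hullP.
exists (rescale t l ++ rescale (1 - t) m); split.
- by move=> p; rewrite mem_cat => /orP[] /mem_rescale[q ql ->];
    [exact: Sl ql|exact: Sm ql].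
- move=> p; rewrite mem_cat => /orP[] /mem_rescale[q ql ->] /=.
    by rewrite mulr_ge0// l0.
  by rewrite mulr_ge0 ?subr_ge0// m0.
- by rewrite weight_cat !weight_rescale l1 m1; ring.
- by rewrite lincomb_cat !lincomb_rescale.
Qed.

(** Normalizing only at the end turns the induction on the list into a
    statement about nonnegative combinations of arbitrary positive weight. *)
Lemma lincomb_convex V (G : set V) l : convex_set G ->
  (forall p, p \in l -> G p.2) -> (forall p, p \in l -> 0 <= p.1) ->
  0 < weight l -> G ((weight l)^-1 *: lincomb id l).
Proof.
move=> /convex_setP cG; elim: l => [|[a x] l IH] Gl l0.
  by rewrite /weight big_nil ltxx.
have Gx : G x by apply: (Gl (a, x)); rewrite mem_head.
have a0 : 0 <= a by apply: (l0 (a, x)); rewrite mem_head.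
have {}Gl p : p \in l -> G p.2 by move=> pl; apply: Gl; rewrite inE pl orbT.
have {}l0 p : p \in l -> 0 <= p.1 by move=> pl; apply: l0; rewrite inE pl orbT.
have := weight_ge0 _ _ l0; rewrite le_eqVlt => /predU1P[w0|w0].
  rewrite lincomb_cons (lincomb_weight0 _ _ _ l)// weight_cons -w0 !addr0 /= => a1.
  by rewrite scalerA mulVf ?scale1r// gt_eqF.
rewrite weight_cons lincomb_cons /= => aw.
have -> : (a + weight l)^-1 *: (a *: x + lincomb id l) =
    (a / (a + weight l)) *: x +
    (1 - a / (a + weight l)) *: ((weight l)^-1 *: lincomb id l).
  rewrite scalerDr !scalerA; congr (_ *: _ + _ *: _); first exact: mulrC.
  by field; rewrite !gt_eqF.
apply: cG => //; first exact: IH.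
by rewrite divr_ge0// ?(ltW aw)//= ler_pdivrMr// mul1r lerDl ltW.
Qed.

Lemma hull_sub V (S G : set V) :
  convex_set G -> S `<=` G -> convex_hull S `<=` G.
Proof.
move=> cG SG x /convex_hullP[l [Sl l0 l1 <-]].
have := @lincomb_convex _ G l cG; rewrite l1 invr1 scale1r; apply=> //.
by move=> p /Sl /SG.
Qed.

(** Collecting the terms at s and normalizing the others, which fails only
    when the others have total weight 0. *)
Lemma hull_split V (S : set V) s y : convex_hull S y ->
  y = s \/ exists a z, [/\ 0 <= a < 1, convex_hull (S `\ s) z
                         & y = a *: s + (1 - a) *: z].
Proof.
move=> /convex_hullP[l [Sl l0 l1 <-]].
pose ls := [seq p <- l | p.2 == s]; pose lr := [seq p <- l | p.2 != s].
have wE : weight ls + weight lr = 1.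
  by rewrite -l1 /weight !big_filter [RHS](bigID (fun p => p.2 == s)).
have -> : lincomb id l = weight ls *: s + lincomb id lr.
  rewrite /lincomb /weight !big_filter (bigID (fun p => p.2 == s)) /=.
  by congr (_ + _); rewrite scaler_suml; apply: eq_bigr => p /eqP ->.
have lr0 p : p \in lr -> 0 <= p.1.
  by rewrite mem_filter => /andP[_]; exact: l0.
have := weight_ge0 _ _ lr0; rewrite le_eqVlt => /predU1P[w0|w0].
  left; rewrite (lincomb_weight0 _ _ _ lr)// addr0.
  by move: wE; rewrite -w0 addr0 => ->; rewrite scale1r.
right; exists (weight ls), ((weight lr)^-1 *: lincomb id lr); split.
- rewrite weight_ge0 => [|p]; last by rewrite mem_filter => /andP[_]; exact: l0.
  by rewrite -wE ltrDl.
- apply: lincomb_convex => //; first exact: hull_convex.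
  move=> p; rewrite mem_filter => /andP[/eqP ps /Sl Sp].
  by apply: sub_hull; split.
- have -> : 1 - weight ls = weight lr by rewrite -wE; ring.
  by rewrite scalerA divff ?scale1r// gt_eqF.
Qed.

(** * Extreme points *)

Lemma line_fixed V (s z : V) (t : R) : t != 1 -> s = t *: s + (1 - t) *: z -> z = s.
Proof.
move=> t1 sE; apply: (@scalerI _ _ (1 - t)); first by rewrite subr_eq0 eq_sym.
by apply/esym; rewrite [LHS]scalerBl scale1r {1}sE addrC addKr.
Qed.

(** If s is not extreme, it lies strictly between two points of the hull that
    are not both s. Expand these two points along s as in hull_split: solving
    the resulting equation for s, whose coefficient on the right is less than
    1, expresses s through the other points. *)
Lemma not_extreme V (S : set V) s : S s -> ~ vert (convex_hull S) s ->
  convex_hull (S `\ s) s.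
Proof.
move=> Ss; apply: contra_notP => sS; split; first exact: sub_hull.
move=> y z t Hy Hz /andP[t0 t1] sE.
have [yE|[a [y' [/andP[a0 a1] Hy' yE]]]] := hull_split _ _ s _ Hy.
  by split=> //; apply: (line_fixed _ s z t); rewrite ?lt_eqF// -[in t *: s]yE.
have [zE|[b [z' [/andP[b0 b1] Hz' zE]]]] := hull_split _ _ s _ Hz.
  split=> //; apply: (line_fixed _ s y (1 - t)); first by rewrite lt_eqF// gtrBl.
  by rewrite subKr -[in _ *: s]zE addrC.
exfalso; apply: sS; set H := convex_hull _.
(* g is the coefficient of s in t y + (1 - t) z. *)
pose g := t * a + (1 - t) * b.
have g1 : 0 < 1 - g by rewrite /g; nra.
have <- : (t * (1 - a) / (1 - g)) *: y' + (1 - t * (1 - a) / (1 - g)) *: z' = s.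
  apply: (line_fixed _ s _ g); first by rewrite lt_eqF// -subr_gt0.
  rewrite {1}sE yE zE !scalerDr !scalerA addrACA -scalerDl.
  congr (_ *: _ + (_ *: _ + _ *: _)); rewrite /g; field; move: g1; rewrite /g;
  by move=> /gt_eqF; rewrite /= => /negbT.
have /convex_setP cH := hull_convex _ (S `\ s); rewrite /H; apply: cH => //.
rewrite divr_ge0 ?(ltW g1) ?mulr_ge0 ?subr_ge0 ?(ltW t0) ?(ltW a1)//=.
by rewrite ler_pdivrMr// /g; nra.
Qed.

(** Removing an extreme point from a convex set leaves it convex; so if the
    extreme point were outside S, the hull of S would be smaller than itself. *)
Lemma vert_hull_sub V (S : set V) : vert (convex_hull S) `<=` S.
Proof.
move=> x [Hx xext]; apply: contrapT => Sx.
suff : (convex_hull S `\ x) x by case=> _; exact.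
apply: (hull_sub _ S) Hx; last first.
  by move=> y Sy; split; [exact: sub_hull|move=> yx; apply: Sx; rewrite -yx].
apply/convex_setP => y z t [Hy yx] [Hz zx] /andP[t0 t1]; split.
  by have /convex_setP := hull_convex _ S; apply=> //; rewrite t0.
move: t0; rewrite le_eqVlt => /predU1P[<-|t0].
  by rewrite scale0r add0r subr0 scale1r.
move: t1; rewrite le_eqVlt => /predU1P[->|t1].
  by rewrite scale1r subrr scale0r addr0.
by move=> /esym xE; have [] := xext y z t Hy Hz; rewrite ?t0 ?t1.
Qed.

(** Discarding the points that are not extreme, one at a time, does not change
    the hull, by not_extreme; when all remaining points are extreme, they are
    exactly the vertices. *)
Lemma hull_vertP V (s : seq V) : exists u : seq V,
  [/\ uniq u, vert (convex_hull [set` s]) = [set` u] &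
      convex_hull [set` s] = convex_hull [set` u]].
Proof.
have [n] := ubnP (size s); elim: n s => // n IH s; rewrite ltnS => sn.
have [allv|/existsNP[x /not_implyP[xs xv]]] :=
    pselect (forall x, x \in s -> vert (convex_hull [set` s]) x).
  exists (undup s); split; rewrite ?undup_uniq//.
    apply/seteqP; split=> x /=; rewrite mem_undup; last exact: allv.
    exact: vert_hull_sub.
  by congr convex_hull; apply/seteqP; split=> x /=; rewrite mem_undup.
pose s' := [seq y <- s | y != x].
have s'E : [set` s'] = [set` s] `\ x.
  apply/seteqP; split=> y /=; rewrite mem_filter.
    by move=> /andP[/eqP yx ys].
  by move=> [ys /eqP yx]; rewrite yx.
have HE : convex_hull [set` s'] = convex_hull [set` s].
  apply/seteqP; split; apply: hull_sub; try exact: hull_convex.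
    by move=> y; rewrite s'E => -[ys _]; exact: sub_hull.
  move=> y ys; have [->|yx] := eqVneq y x; last first.
    by apply: sub_hull; rewrite s'E; split=> //; exact/eqP.
  by rewrite s'E; exact: not_extreme.
rewrite -HE; apply: IH; apply: leq_trans sn.
by rewrite size_filter -(count_predC (fun y => y != x) s) -[X in (X < _)%N]addn0
  ltn_add2l -has_count; apply/hasP; exists x; rewrite //= eqxx.
Qed.

(** * Dimension *)

(** Greedy extraction of a basis. The bound on n is what leaves room for a
    natural number m in the number n + m + 1 of vertices. *)
Lemma lin_indep_span V k (v : 'I_k -> V) : exists n (w : 'I_n -> V),
  [/\ (n <= k)%N, lin_indep w &
   [set \sum_i c i *: v i | c in [set: 'I_k -> R]] =
   [set \sum_i c i *: w i | c in [set: 'I_n -> R]]].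
Proof.
elim: k v => [|k IH] v; first by exists 0, v; split=> // c _ [].
have [n [w [nk wind spanE]]] := IH (fun i => v (lift ord0 i)).
have splitv (c : 'I_k.+1 -> R) : exists d : 'I_n -> R,
    \sum_i c i *: v i = c ord0 *: v ord0 + \sum_i d i *: w i.
  have [d _ dE] : [set \sum_i d i *: w i | d in [set: 'I_n -> R]]
      (\sum_(i < k) c (lift ord0 i) *: v (lift ord0 i)).
    by rewrite -spanE; exists (fun i => c (lift ord0 i)).
  by exists d; rewrite big_ord_recl dE.
have splitw a (d : 'I_n -> R) : exists2 c : 'I_k.+1 -> R, c ord0 = a &
    a *: v ord0 + \sum_i d i *: w i = \sum_i c i *: v i.
  have [c _ cE] : [set \sum_(i < k) c i *: v (lift ord0 i) | c in [set: 'I_k -> R]]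
      (\sum_i d i *: w i).
    by rewrite spanE; exists d.
  exists (fun i => oapp c a (unlift ord0 i)); rewrite ?unlift_none//.
  rewrite big_ord_recl unlift_none /= -cE; congr (_ + _).
  by apply: eq_bigr => i _; rewrite liftK.
have [[e _ eE]|v0w] :=
    pselect ([set \sum_i d i *: w i | d in [set: 'I_n -> R]] (v ord0)).
  exists n, w; split=> //; first exact: leqW.
  apply/seteqP; split=> [_ [c _ <-]|_ [d _ <-]].
    have [d ->] := splitv c; exists (fun i => c ord0 * e i + d i) => //.
    rewrite -eE scaler_sumr -big_split; apply: eq_bigr => i _.
    by rewrite scalerDl scalerA.
  have [c _ cE] := splitw 0 d; exists c => //.
  by rewrite -cE scale0r add0r.
exists n.+1, (fun i => oapp w (v ord0) (unlift ord0 i)).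
have wE (c : 'I_n.+1 -> R) : \sum_i c i *: oapp w (v ord0) (unlift ord0 i) =
    c ord0 *: v ord0 + \sum_(i < n) c (lift ord0 i) *: w i.
  rewrite big_ord_recl unlift_none; congr (_ + _).
  by apply: eq_bigr => i _; rewrite liftK.
split=> //.
  move=> c; rewrite wE => cE.
  have c0 : c ord0 = 0.
    apply: contra_notP v0w => /eqP c0.
    exists (fun i => - (c ord0)^-1 * c (lift ord0 i)) => //.
    under eq_bigr do rewrite -scalerA.
    rewrite -scaler_sumr; apply: (scalerI c0).
    by rewrite scalerA mulrN divff// scaleN1r; apply/esym/eqP; rewrite -addr_eq0 cE.
  move=> i; have [j ->|->//] := unliftP ord0 i.
  by apply: (wind (fun j => c (lift ord0 j))); move: cE; rewrite c0 scale0r add0r.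
apply/seteqP; split=> [_ [c _ <-]|_ [c _ <-]].
  have [d ->] := splitv c.
  exists (fun i => oapp d (c ord0) (unlift ord0 i)) => //.
  rewrite wE unlift_none; congr (_ + _).
  by apply: eq_bigr => i _; rewrite liftK.
by rewrite wE; have [d _ dE] := splitw (c ord0) (fun i => c (lift ord0 i)); exists d.
Qed.

Lemma affine_dim_aff V (x0 : V) (s : seq V) : exists2 n, (n <= size s)%N &
  affine_dim (aff [set` x0 :: s]) n.
Proof.
have [n [w [ns wind spanE]]] :=
  lin_indep_span _ (size s) (fun i => tnth (in_tuple s) i - x0).
exists n => //; exists x0, w; split=> //.
have {spanE} -> : [set x0 + \sum_i c i *: w i | c in [set: 'I_n -> R]] =
    [set x0 + x | x in [set \sum_i c i *: (tnth (in_tuple s) i - x0)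
                         | c in [set: 'I_(size s) -> R]]].
  by rewrite spanE -image_comp.
apply/seteqP; split.
  apply: aff_sub => [_ _ t [_ [c _ <-] <-] [_ [d _ <-] <-]|x].
    eexists; first by exists (fun i => t * c i + (1 - t) * d i).
    rewrite !scalerDr addrACA -scalerDl subrKC scale1r; congr (_ + _).
    rewrite !scaler_sumr -big_split; apply: eq_bigr => i _.
    by rewrite scalerDl !scalerA.
  rewrite /= inE => /predU1P[->|xs].
    exists 0; rewrite ?addr0//; exists (fun=> 0) => //.
    by rewrite big1// => i _; rewrite scale0r.
  have /tnthP[i xE] : x \in in_tuple s by [].
  exists (x - x0); last by rewrite addrC subrK.
  exists (fun j => (j == i)%:R) => //.
  rewrite (bigD1 i)//= eqxx scale1r -xE big1 ?addr0// => j /negbTE ->.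
  exact: scale0r.
move=> _ [_ [c _ <-] <-].
apply/affP; exists ((1 - \sum_i c i, x0) ::
   [seq (c i, tnth (in_tuple s) i) | i <- index_enum 'I_(size s)]); split.
- move=> p; rewrite inE => /predU1P[->|/mapP[i _ ->]] /=; first exact: mem_head.
  by rewrite inE [X in _ || X]mem_tnth orbT.
- by rewrite weight_cons /weight big_map /= subrK.
- rewrite lincomb_cons /lincomb big_map /=.
  under [in RHS]eq_bigr do rewrite scalerBr.
  by rewrite sumrB -scaler_suml scalerBl scale1r -!addrA; congr (_ + _); rewrite addrC.
Qed.

(** The dimension is measured from one of the vertices, so that n + 1 is at most
    the number of vertices. *)
Lemma polyhedronP V (s : seq V) : s != [::] ->
  exists n m, nm_polyhedron n m (convex_hull [set` s]).
Proof.
move=> s0; have [u [uu vE HE]] := hull_vertP _ s.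
case: u => [|x0 u] in uu vE HE *.
  case: s s0 vE HE => // a s _ _ HE.
  have : convex_hull [set` a :: s] a by apply: sub_hull; exact: mem_head.
  rewrite HE => /convex_hullP[[|p l] [Sl _ l1 _]].
    by move: l1; rewrite /weight big_nil => /eqP; rewrite eq_sym oner_eq0.
  by have := Sl p (mem_head _ _).
have [n nu dimn] := affine_dim_aff _ x0 u.
exists n, (size u - n)%N; split.
- by exists [set` s] => //; exact: finite_seq.
- by rewrite HE aff_hull.
- rewrite vE subnKC// addn1.
have -> : [set` x0 :: u] = [set` [fset x in x0 :: u]%fset].
  by apply/seteqP; split=> x /=; rewrite in_fset.
by apply/card_eq_fsetP; rewrite card_fseq undup_id.
Qed.

End Combinations.

(** * Almost isometric copies *)

Section Approximation.
Context {R : realType}.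

Lemma norm_lincomb_le (I : eqType) (V : normedModType R) (f : I -> V) (e : R) l :
  (forall p, p \in l -> `|f p.2| <= e) ->
  `|lincomb f l| <= e * \sum_(p <- l) `|p.1|.
Proof.
move=> fe; apply: le_trans (ler_norm_sum _ _ _) _.
rewrite mulr_sumr big_seq [leRHS]big_seq; apply: ler_sum => p pl.
by rewrite normrZ mulrC ler_wpM2r// fe.
Qed.

Lemma lincombB (I : Type) (V : lmodType R) (f g : I -> V) (l : seq (R * I)) :
  lincomb (fun x => f x - g x) l = lincomb f l - lincomb g l.
Proof.
by rewrite /lincomb -sumrB; apply: eq_bigr => p _; rewrite scalerBr.
Qed.

Lemma vert_image (V W : lmodType R) (S : set V) (T : V -> W) v :
  affine_on (aff S) T -> set_inj (aff S) T ->
  vert (convex_hull S) v -> vert (T @` convex_hull S) (T v).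
Proof.
move=> Taff Tinj [Hv vext].
have Haff x : convex_hull S x -> aff S x.
  by move=> Hx; rewrite -aff_hull; exact: sub_aff.
split; first by exists v.
move=> _ _ t [y Hy <-] [z Hz <-] t01.
rewrite -(Taff y z t (Haff _ Hy) (Haff _ Hz)) => /Tinj vE.
have [] := vext y z t Hy Hz t01; last by move=> -> ->.
by apply: vE; apply/mem_set; [|apply: aff_line]; exact: Haff.
Qed.

Lemma hausdorff_near (Y : normedModType R) (C D : set Y) (e : R) :
  (hausdorff_dist C D < e%:E)%E ->
  forall c, C c -> exists2 d, D d & `|c - d| <= e.
Proof.
move=> /ereal_inf_lt[_ [r [r0 CD _] <-]]; rewrite lte_fin => re c /CD[d Dd [b]].
rewrite closed_ballE// /closed_ball_ /= sub0r normrN => b1 <-; exists d => //.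
rewrite addrC addKr normrZ gtr0_norm// (le_trans _ (ltW re))//.
by rewrite ler_piMr// ltW.
Qed.

Lemma approx_hull (V W : normedModType R) (S : set V) (T : V -> W) (B : set W)
    (e : R) x :
  affine_on (aff S) T -> convex_set B ->
  (forall v, S v -> exists2 b, B b & `|T v - b| <= e) ->
  convex_hull S x -> exists2 b, B b & `|T x - b| <= e.
Proof.
move=> Taff cB Tb /convex_hullP[l [Sl l0 l1 <-]].
have /choice[f fP] v : exists b, S v -> B b /\ `|T v - b| <= e.
  have [/Tb[b Bb be]|nS] := pselect (S v); first by exists b.
  by exists 0.
exists (lincomb f l).
  have := @lincomb_convex _ _ B [seq (p.1, f p.2) | p <- l] cB.
  rewrite weight_map l1 invr1 scale1r lincomb_map; apply => //.
  - by move=> _ /mapP[p pl ->]; have [] := fP _ (Sl p pl).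
  - by move=> _ /mapP[p pl ->]; exact: l0 pl.
rewrite (affine_on_lincomb _ _ S)// -lincombB.
apply: le_trans (norm_lincomb_le _ _ _ e _ _) _.
  by move=> p pl; have [] := fP _ (Sl p pl).
rewrite [X in e * X](_ : _ = 1) ?mulr1//.
by rewrite -l1 /weight big_seq [RHS]big_seq; apply: eq_bigr => p /l0/ger0_norm.
Qed.

(** The estimate needs coefficients of sum 0 because such combinations are the
    differences of points of the affine hull, which is where T is an
    e-isometry. The total of their absolute values measures the cost of
    replacing T by the nearby values f in B. *)
Lemma almost_isometric_copy (X Y : normedModType R) (A : set X) (B : set Y)
    (e : R) (s : seq X) :
  convex_set B -> 0 < e -> eps_strongly_finitely_representable e A B ->
  exists b : X -> Y, (forall a, A a -> B (b a)) /\
    forall l, (forall p, p \in l -> A p.2 /\ p.2 \in s) -> weight l = 0 ->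
      `| `|lincomb b l| - `|lincomb id l| | <=
        e * (`|lincomb id l| + \sum_(p <- l) `|p.1|).
Proof.
move=> cB e0 AB.
have [[a0 Aa0]|A0] := pselect (exists a, A a); last first.
  exists (fun=> 0); split=> [a Aa|[|p l] Al _]; first by case: A0; exists a.
    by rewrite /lincomb !big_nil !normr0 subrr addr0 mulr0 normr0.
  by case: A0; exists p.2; have [] := Al p (mem_head _ _).
(* The point a0 makes F nonempty, as required for a polyhedron, and yields a
   point of B to serve as the value of b outside F. *)
pose F := a0 :: [seq a <- s | `[< A a >]].
have FA a : a \in F -> A a.
  by rewrite inE => /predU1P[->//|]; rewrite mem_filter => /andP[/asboolP].
have [//|n [m nmH]] := polyhedronP X F.
have [|H' [T [_ vB' [Taff Tbij] Tiso dist]]] := AB n m _ nmH.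
  by move=> x /vert_hull_sub /FA.
rewrite aff_hull in Taff Tbij Tiso.
have Tb a : a \in F -> exists2 b, B b & `|T a - b| <= e.
  move=> aF; have [u [_ vE HE]] := hull_vertP _ F.
  have Ha : convex_hull [set` u] a by rewrite -HE; exact: sub_hull.
  have affE : aff [set` F] = aff [set` u] by rewrite -aff_hull HE aff_hull.
  apply: (approx_hull _ _ [set` u] T B e a) => //; first by rewrite -affE.
  move=> v uv; have [|b B'b be] := hausdorff_near _ _ _ _ dist (T v).
    by apply: vert_image => //; [exact: set_bij_inj Tbij|rewrite vE].
  by exists b => //; exact: vB'.
have /choice[f fP] a : exists b, (a \in F -> `|T a - b| <= e) /\ B b.
  have [/Tb[b Bb be]|aF] := boolP (a \in F); first by exists b.
  by have [b Bb _] := Tb a0 (mem_head _ _); exists b.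
exists f; split=> [a _|l Al l0]; first by have [] := fP a.
have lF p : p \in l -> p.2 \in F.
  by move=> /Al[Ap ps]; rewrite inE mem_filter ps andbT; apply/orP; right; apply/asboolP.
have l'F p : p \in (1, a0) :: l -> p.2 \in F.
  by rewrite inE => /predU1P[->|/lF//]; rewrite /= mem_head.
have l'1 : weight ((1, a0) :: l) = 1 by rewrite weight_cons l0 addr0.
(* Based at a0, the combination l becomes the point a0 + lincomb id l of aff F. *)
have Tl : lincomb T l = T (lincomb id ((1, a0) :: l)) - T a0.
  rewrite (affine_on_lincomb _ _ [set` F])// lincomb_cons scale1r /=.
  by rewrite addrC addKr.
have := Tiso (lincomb id ((1, a0) :: l)) a0 (lincomb_aff _ _ _ l'F l'1) _.
rewrite -Tl lincomb_cons scale1r /= [a0 + _ - _]addrC addKr.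
move=> /(_ (sub_aff _ _ _ (mem_head _ _))) Tiso'.
have : `|lincomb T l - lincomb f l| <= e * \sum_(p <- l) `|p.1|.
  rewrite -lincombB; apply: norm_lincomb_le => p /lF pF.
  by have [+ _] := fP p.2; exact.
move=> /(le_trans (ler_dist_dist _ _)).
move: Tiso'; rewrite !ler_norml => /andP[? ?] /andP[? ?].
apply/andP; split; nra.
Qed.

End Approximation.

(** * The ultrafilter *)

Section Ultrafilter.
Context {X : eqType}.

Definition cone (i : seq X * nat) : set (seq X * nat) :=
  [set j : seq X * nat | {subset i.1 <= j.1} /\ (i.2 <= j.2)%N].

(** The natural number component grows beyond any bound along the cones, so no
    index lies in all of them: the ultrafilter is free even if A is finite. *)
Lemma cone_ultrafilter : exists U : set_system (seq X * nat),
  [/\ UltraFilter U, free_filter U & forall i, U (cone i)].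
Proof.
have cF : ProperFilter (filter_from [set: seq X * nat] cone).
  apply: filter_from_proper; last by move=> i _; exists i; split.
  apply: filter_from_filter; first by exists ([::], 0%N).
  move=> i j _ _; exists (i.1 ++ j.1, maxn i.2 j.2) => // k [sk nk].
  split; split=> /=.
  - by move=> x xi; apply: sk; rewrite mem_cat xi.
  - by apply: leq_trans nk; rewrite leq_maxl.
  - by move=> x xj; apply: sk; rewrite mem_cat xj orbT.
  - by apply: leq_trans nk; rewrite leq_maxr.
have [U [UU cU]] := ultraFilterLemma cF.
have Ucone i : U (cone i) by apply: cU; exists i.
exists U; split=> //; rewrite /free_filter; apply/seteqP; split=> // i.
move=> /(_ _ (Ucone ([::], i.2.+1))).
by case=> _ /=; rewrite ltnn.
Qed.

End Ultrafilter.

(** * The embedding *)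

Theorem lemma3p3 (R : realType) (X Y : completeNormedModType R)
    (A : set X) (B : set Y) :
  convex_set B ->
  strongly_finitely_representable A B ->
  exists (I : Type) (U : set_system I) (UU : UltraFilter U)
         (T : X -> ultra_quot Y U),
    [/\ free_filter U,
        ultra_affine_isometry (aff A) T,
        T @` aff A `<=` ultrapower U (aff B)
      & T @` A `<=` ultrapower U B].
Proof.
move=> cB AB.
have [U [UU Ufree Ucone]] := @cone_ultrafilter X.
have eps0 n : 0 < n.+1%:R^-1 :> R by rewrite invr_gt0.
have [b bP] := choice (fun i : seq X * nat =>
  almost_isometric_copy X Y A B _ i.1 cB (eps0 i.2) (AB _ (eps0 i.2))).
have bB i a : A a -> B (b i a) by have [+ _] := bP i; exact.
have near_norm l (e : R) : (forall p, p \in l -> A p.2) -> weight l = 0 -> 0 < e ->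
    \forall i \near U, `| `|lincomb (b i) l| - `|lincomb id l| | < e.
  move=> Al l0 e0; set M := `|lincomb id l| + \sum_(p <- l) `|p.1|.
  have M0 : 0 <= M by rewrite addr_ge0// sumr_ge0.
  have [k] : exists k, 0 + k.+1%:R^-1 < e / (M + 1).
    by apply: ltr_add_invr; rewrite divr_gt0// ltr_wpDl.
  rewrite add0r ltr_pdivlMr ?ltr_wpDl// => ke.
  (* In this cone i.1 contains the points of l, and the error bound
     M / (i.2 + 1) is less than e. *)
  apply: filterS (Ucone ([seq p.2 | p <- l], k)) => i [li ki].
  have [_ bi] := bP i; apply: le_lt_trans (bi l _ l0) _.
    by move=> p pl; split; [exact: Al|apply: li; apply/mapP; exists p].
  apply: le_lt_trans ke; rewrite -/M ler_pM ?invr_ge0 ?ler0n ?lerDl//.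
  by rewrite lef_pV2 ?posrE ?ltr0n// ler_nat.
have /choice[rep repP] x : exists l : seq (R * X), aff A x ->
    [/\ forall p, p \in l -> A p.2, weight l = 1 & lincomb id l = x].
  have [/affP[l lx]|nx] := pselect (aff A x); first by exists l.
  by exists [::].
exists (seq X * nat)%type, U, UU.
exists (fun x => \pi_(ultra_quot Y U) (fun i => lincomb (b i) (rep x)))%qT.
split=> //.
- split=> [x y t Ax Ay|x y Ax Ay].
    rewrite ultra_comb_pi; apply/ultra_quotP => e e0.
    have [Ar r1 rE] := repP _ (aff_line _ _ _ _ t Ax Ay).
    have [Arx rx1 rxE] := repP _ Ax.
    have [Ary ry1 ryE] := repP _ Ay.
    pose l := rep (t *: x + (1 - t) *: y) ++
      rescale (- t) (rep x) ++ rescale (- (1 - t)) (rep y).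
    have lE (V : lmodType R) (f : X -> V) : lincomb f l =
        lincomb f (rep (t *: x + (1 - t) *: y)) -
        (t *: lincomb f (rep x) + (1 - t) *: lincomb f (rep y)).
      by rewrite !lincomb_cat !lincomb_rescale !scaleNr -opprD.
    have := near_norm l e; rewrite (lE X) rE rxE ryE subrr normr0.
    have Al p : p \in l -> A p.2.
      rewrite !mem_cat => /or3P[/Ar//|/mem_rescale[q ql ->]|/mem_rescale[q ql ->]].
        exact: Arx ql.
      exact: Ary ql.
    have l0 : weight l = 0.
      by rewrite !weight_cat !weight_rescale r1 rx1 ry1; ring.
    move=> /(_ Al l0 e0); apply: filterS => i.
    by rewrite (lE Y) subr0 normr_id.
  rewrite ultra_dist_pi; apply: cvg_lim => //.
  apply/fine_cvgP; split; first exact: nearW.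
  apply/cvgrPdist_lt => e e0.
  have [Arx rx1 rxE] := repP _ Ax.
  have [Ary ry1 ryE] := repP _ Ay.
  pose l := rep x ++ rescale (-1) (rep y).
  have lE (V : lmodType R) (f : X -> V) : lincomb f l =
      lincomb f (rep x) - lincomb f (rep y).
    by rewrite !lincomb_cat !lincomb_rescale !scaleN1r.
  have := near_norm l e; rewrite (lE X) rxE ryE.
  have Al p : p \in l -> A p.2.
    rewrite mem_cat => /orP[/Arx//|/mem_rescale[q ql ->]].
    exact: Ary ql.
  have l0 : weight l = 0 by rewrite weight_cat weight_rescale rx1 ry1; ring.
  move=> /(_ Al l0 e0); apply: filterS => i.
  by rewrite (lE Y) distrC.
- move=> _ [x Ax <-]; have [Ar r1 rE] := repP _ Ax.
  exists (fun i => lincomb (b i) (rep x)) => // i.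
  rewrite -[b i](@compA _ _ _ _ id id) -lincomb_map; apply: lincomb_aff.
    by move=> _ /mapP[p pl ->]; apply: bB; exact: Ar.
  by rewrite weight_map.
- move=> _ [a Aa <-]; have [Ar r1 rE] := repP _ (sub_aff _ _ _ Aa).
  exists (fun i => b i a); first by move=> i; exact: bB.
  apply/ultra_quotP => e e0.
  pose l := (-1, a) :: rep a.
  have := near_norm l e; rewrite lincomb_cons /= rE scaleN1r addNr normr0.
  have Al p : p \in l -> A p.2 by rewrite inE => /predU1P[->//|/Ar].
  have l0 : weight l = 0 by rewrite weight_cons r1 /= addNr.
  move=> /(_ Al l0 e0); apply: filterS => i.
  by rewrite lincomb_cons /= scaleN1r subr0 normr_id addrC distrC.
Qed.
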